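(* Let $\Phi:\mathcal{I}\to\mathbb{R}$ be a smooth function on an open interval $\mathcal{I}\subset\mathbb{R}$. The following statements are equivalent. 1. $A^\Phi$ is convex on $\mathcal{T}_{\mathcal{I}}$; 2. $B^\Phi$ is convex on $\mathcal{T}_{\mathcal{I}}$; 3. $C^\Phi$ is convex on $\mathcal{T}'_{\mathcal{I}}$; 4. either $\Phi$ is affine on $\mathcal{I}$, or $\Phi''>0$ on $\mathcal{I}$ and $-1/\Phi''$ is convex on $\mathcal{I}$; 5. for any $t\in[0,1]$, the function $(a,b)\in\mathcal{I}\times\mathcal{I}\mapsto t\Phi(a)+(1-t)\Phi(b)-\Phi(ta+(1-t)b)$ is convex on $\mathcal{I}\times\mathcal{I}$; 6. for any probability space $(E,\mathcal{E},Q)$, the functional $\mathbf{Ent}_Q^\Phi$ is convex on $\mathcal{K}(E,\mathcal{I})$; 7. there exists a covering collection $\mathcal{P}$ such that $\mathbf{Ent}_Q^\Phi$ is convex on $\mathcal{K}(E,\mathcal{I})$ for any $(E,\mathcal{E},Q)\in\mathcal{P}$; 8. for any probability space $(E,\mathcal{E},Q)$ and any $f\in\mathcal{K}(E,\mathcal{I})$, $$\mathbf{Ent}_Q^\Phi(f)=\sup_{g\in\mathcal{K}(E,\mathcal{I})}\Big\{\mathbf{E}_Q\big((\Phi'(g)-\Phi'(\mathbf{E}_Qg))(f-g)\big)+\mathbf{Ent}_Q^\Phi(g)\Big\};\qquad(\star)$$ 9. there exists a covering collection $\mathcal{P}$ such that $(\star)$ holds for any $(E,\mathcal{E},Q)\in\mathcal{P}$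 and any $f\in\mathcal{K}(E,\mathcal{I})$; 10. for any $n\geq1$, any product probability space $(E,\mathcal{E},Q):=(E_1\times\cdots\times E_n,\mathcal{E}_1\otimes\cdots\otimes\mathcal{E}_n,Q_1\otimes\cdots\otimes Q_n)$, and any $f\in\mathcal{K}(E,\mathcal{I})$, $$\mathbf{Ent}_Q^\Phi(f)\leq\mathbf{E}_Q\big(\mathbf{Ent}_{Q_1}^\Phi(f)\big)+\cdots+\mathbf{E}_Q\big(\mathbf{Ent}_{Q_n}^\Phi(f)\big),\qquad(\star\star)$$ where the expectations with respect to $Q_i$ in $\mathbf{Ent}_{Q_i}^\Phi(f)$ concern only the $i$-th coordinate; 11. there exists a covering collection $\mathcal{P}$ such that $(\star\star)$ holds for $n=2$, any $Q_1\in\{\mathcal{B}(1,p);p\in[0,1]\}$ (on $E_1=\{0,1\}$), any $(E_2,\mathcal{E}_2,Q_2)\in\mathcal{P}$, and any $f\in\mathcal{K}(E_1\times E_2,\mathcal{I})$. Moreover, if these statements hold, then $\Phi$ and $\Phi''$ are convex on $\mathcal{I}$.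
   Context: For an open interval $\mathcal{I}\subset\mathbb{R}$, $\mathcal{T}_{\mathcal{I}}:=\{(u,v)\in\mathbb{R}^2: u\in\mathcal{I},\,u+v\in\mathcal{I}\}$ and $\mathcal{T}'_{\mathcal{I}}:=\{(u,v)\in\mathbb{R}^2: u\in\mathcal{I},\,(v+\mathcal{I})\cap\mathcal{I}\neq\emptyset\}$; both are convex. The transforms $A^\Phi,B^\Phi:\mathcal{T}_{\mathcal{I}}\to\mathbb{R}$ and $C^\Phi:\mathcal{T}'_{\mathcal{I}}\to\mathbb{R}$ are $$A^\Phi(u,v):=\Phi(u+v)-\Phi(u)-\Phi'(u)v,\quad B^\Phi(u,v):=(\Phi'(u+v)-\Phi'(u))v,\quad C^\Phi(u,v):=\Phi''(u)v^2.$$ For a probability space $(E,\mathcal{E},Q)$, $\mathcal{K}(E,\mathcal{I})$ is the convex set of measurable functions $E\to\mathcal{I}$ whose image is relatively compact in $\mathcal{I}$; $\mathbf{E}_Q$ is the mean under $Q$; $\mathbf{Ent}_Q^\Phi(f):=\mathbf{E}_Q(\Phi(f))-\Phi(\mathbf{E}_Qf)$. $\mathcal{B}(1,p)=(1-p)\delta_0+p\delta_1$ is the Bernoulli law on $\{0,1\}$. A collection $\mathcal{P}$ of probability spaces is a covering collection if $\{Q(T): T\in\mathcal{E},\,(E,\mathcal{E},Q)\in\mathcal{P}\}=[0,1]$. *)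

(* Defs.v *)
From HB Require Import structures.
From mathcomp Require Import all_boot all_order all_algebra.
From mathcomp Require Import all_classical all_reals all_analysis.
Import Order.TTheory GRing.Theory Num.Theory.
Import numFieldNormedType.Exports.

Set Implicit Arguments.
Unset Strict Implicit.
Unset Printing Implicit Defensive.

Local Open Scope ring_scope.
Local Open Scope classical_set_scope.

(* In everything below [Phi] stands for a function defined on the open interval
   [I]; it is extended arbitrarily to the whole line, and its values and its
   derivatives are only ever used at points of [I]. *)

Definition smooth_on (R : realType) (I : set R) (Phi : R -> R) : Prop :=
  forall (n : nat) (x : R), I x -> derivable (Phi^`(n)) x 1.

Definition affine_on (R : realType) (I : set R) (Phi : R -> R) : Prop :=
  exists a b : R, forall x, I x -> Phi x = a * x + b.

(* [R^o] is [R] as a module over itself: [convex_function] is stated for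
   functions on a module, here [R^o], [R^o * R^o] or [E -> R^o]. *)
Definition domT (R : realType) (I : set R) : set (R^o * R^o) :=
  [set p | I p.1 /\ I (p.1 + p.2)].

Definition domT' (R : realType) (I : set R) : set (R^o * R^o) :=
  [set p | I p.1 /\ [set p.2 + x | x in I] `&` I !=set0].

Definition transA (R : realType) (Phi : R -> R) (p : R^o * R^o) : R^o :=
  Phi (p.1 + p.2) - Phi p.1 - (Phi^`())%classic p.1 * p.2.

Definition transB (R : realType) (Phi : R -> R) (p : R^o * R^o) : R^o :=
  ((Phi^`())%classic (p.1 + p.2) - (Phi^`())%classic p.1) * p.2.

Definition transC (R : realType) (Phi : R -> R) (p : R^o * R^o) : R^o :=
  (Phi^`(2))%classic p.1 * p.2 ^+ 2.

Definition jensen_gap (R : realType) (Phi : R -> R) (t : R)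
    (p : R^o * R^o) : R^o :=
  t * Phi p.1 + (1 - t) * Phi p.2 - Phi (t * p.1 + (1 - t) * p.2).

Record probSpace (R : realType) := ProbSpace {
  ps_display : measure_display ;
  ps_carrier :> measurableType ps_display ;
  ps_prob : probability ps_carrier R }.

Arguments ProbSpace {R ps_display ps_carrier} ps_prob.

Definition mean (R : realType) (E : probSpace R) (f : E -> R) : R :=
  \int[ps_prob E]_x f x.

Definition Ent (R : realType) (Phi : R -> R) (E : probSpace R)
    (f : E -> R) : R :=
  mean (fun x => Phi (f x)) - Phi (mean f).

(* The image of [f] is relatively compact in [I] exactly when its closure in
   the whole line is compact and contained in [I]. *)
Definition classK (R : realType) (I : set R) (E : probSpace R) :
    set (E -> R^o) :=
  [set f | [/\ measurable_fun setT (f : E -> R),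
               precompact (range f) & closure (range f) `<=` I]].

Arguments classK {R} I E _.

(* The supremum is the one of extended reals, since that of [R] is 0 on
   unbounded sets. *)
Definition variational (R : realType) (Phi : R -> R) (I : set R)
    (E : probSpace R) (f : E -> R) : Prop :=
  (Ent Phi f)%:E = ereal_sup
    [set (mean (fun x => ((Phi^`())%classic (g x) - (Phi^`())%classic (mean g))
                         * (f x - g x))
          + Ent Phi g)%:E | g in classK I E].

Definition covering (R : realType) (P : probSpace R -> Prop) : Prop :=
  [set r%:E | r in `[0%R, 1%R]] =
  [set y : \bar R | exists2 E : probSpace R, P E &
     exists2 A : set E, measurable A & ps_prob E A = y].

Definition bernoulli_space (R : realType) (p : R) : probSpace R :=
  ProbSpace (bernoulli_prob p).

Definition ps_prod (R : realType) (E F : probSpace R) : probSpace R :=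
  ProbSpace (ps_prob E \x ps_prob F)%E.

(* E1 x (E2 x (... x En)), for the nonempty list E1 :: [:: E2; ...; En]. *)
Fixpoint ps_bigprod (R : realType) (E : probSpace R) (s : seq (probSpace R)) :
    probSpace R :=
  if s is F :: s' then ps_prod E (ps_bigprod F s') else E.

(* [Ent_coord Phi i f] maps x to the entropy of f in its coordinate i, counted
   from 0, the other coordinates being those of x. Indices i that exceed
   [size s] are not used. *)
Fixpoint Ent_coord (R : realType) (Phi : R -> R) (i : nat)
    (E : probSpace R) (s : seq (probSpace R)) {struct s} :
    (ps_bigprod E s -> R) -> ps_bigprod E s -> R :=
  match s return (ps_bigprod E s -> R) -> ps_bigprod E s -> R with
  | [::] => fun f _ => Ent Phi f
  | F :: s' => fun f x =>
      if i is i'.+1 then Ent_coord Phi i' (fun z => f (x.1, z)) x.2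
      else Ent Phi (fun y : E => f (y, x.2))
  end.

Definition subadditive_Ent (R : realType) (Phi : R -> R) (I : set R)
    (E : probSpace R) (s : seq (probSpace R)) : Prop :=
  forall f, classK I (ps_bigprod E s) f ->
    Ent Phi f <= \sum_(i < (size s).+1) mean (Ent_coord Phi i (s := s) f).

(* Main.v *)
(** Write phi for the second derivative of Phi. The transforms are tied by
    A(u, v) = d/dt (gap_t(u + v, u)) at t = 0, B(u, v) = A(u, v) + A(u + v, -v)
    and C(u, v) = lim B(u, e v) / e^2, so convexity passes from the Jensen gap
    to A, to B and to C. Conversely the convexity defect of s |-> A(u, s v)
    vanishes to first order at s = 0 and has the defect of C as its second
    derivative. Testing the convexity of C at v_i = e / phi(u_i) gives the
    concavity of 1 / phi, and Cauchy-Schwarz gives the converse.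

    For the entropy, the duality formula is Jensen's inequality for A at the
    random point (g, f - g), obtained from the tangent plane of A at the mean.
    A supremum of affine functionals is convex, functions with two values
    recover the Jensen gap, and duality applied to a partial mean gives
    subadditivity. On a product with a Bernoulli law subadditivity is the
    convexity of the entropy again. *)
Require Import Defs.
From HB Require Import structures.
From mathcomp Require Import all_boot all_order all_algebra.
From mathcomp Require Import all_classical all_reals all_analysis.
From mathcomp Require Import measurable_realfun lra ring.
Import Order.TTheory GRing.Theory Num.Theory.
Import numFieldNormedType.Exports.

Set Implicit Arguments.
Unset Strict Implicit.
Unset Printing Implicit Defensive.

Local Open Scope ring_scope.
Local Open Scope classical_set_scope.

(** * Derivatives on the line *)

(** [convex_function] takes a bundled scalar of the unit interval; the proofs below work with a
    plain real and its bounds. *)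
Lemma convex_functionP (R : realType) (E : lmodType R)
    (D : set (convex_lmodType E)) (f : convex_lmodType E -> R^o) :
  convex_function D f <->
  forall (t : R) (x y : E), 0 <= t <= 1 -> D x -> D y ->
    (f (t *: x + (1 - t) *: y) : R) <= t * f x + (1 - t) * f y.
Proof.
split=> [cf t x y /andP[t0 t1] Dx Dy|cf t x y /set_mem Dx /set_mem Dy].
  exact: (cf (Itv01 t0 t1) x y (mem_set Dx) (mem_set Dy)).
by apply: cf => //; rewrite ge0 le1.
Qed.

Lemma convex_function1P (R : realType) (D : set R^o) (f : R -> R) :
  convex_function (E := R^o) D f <->
  forall t x y : R, 0 <= t <= 1 -> D x -> D y ->
    f (t * x + (1 - t) * y) <= t * f x + (1 - t) * f y.
Proof. by rewrite convex_functionP. Qed.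

Lemma convex_function2P (R : realType) (D : set (R^o * R^o))
    (f : R^o * R^o -> R^o) :
  convex_function (E := (R^o * R^o)%type) D f <->
  forall t u0 v0 u1 v1 : R, 0 <= t <= 1 -> D (u0, v0) -> D (u1, v1) ->
    (f (t * u0 + (1 - t) * u1, t * v0 + (1 - t) * v1) : R) <=
    t * f (u0, v0) + (1 - t) * f (u1, v1).
Proof.
rewrite convex_functionP; split=> [cf t u0 v0 u1 v1|cf t [u0 v0] [u1 v1]].
  exact: cf.
exact: cf.
Qed.

Section derivatives.
Variable R : realType.
Implicit Types (f g h : R -> R) (s x u v a b k : R).

Lemma is_derive_add f g s a b : is_derive s 1 f a -> is_derive s 1 g b ->
  is_derive s 1 (fun x => f x + g x) (a + b).
Proof. by move=> fa gb; exact: is_deriveD. Qed.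

Lemma is_derive_opp f s a : is_derive s 1 f a ->
  is_derive s 1 (fun x => - f x) (- a).
Proof. by move=> fa; exact: is_deriveN. Qed.

Lemma is_derive_mul f g s a b : is_derive s 1 f a -> is_derive s 1 g b ->
  is_derive s 1 (fun x => f x * g x) (f s * b + g s * a).
Proof. by move=> fa gb; exact: is_deriveM. Qed.

(** The combination is a convexity defect at weight [t]; it gets differentiated in [s] for the
    Jensen gap, for A and for the derivative of A along a ray. *)
Lemma is_derive_conv_sub (t : R) f g h s a b k : is_derive s 1 f a ->
  is_derive s 1 g b -> is_derive s 1 h k ->
  is_derive s 1 (fun x => t * f x + (1 - t) * g x - h x) (t * a + (1 - t) * b - k).
Proof.
move=> fa gb hk.
apply: (is_derive_eq (is_derive_add (is_derive_add
  (is_derive_mul (is_derive_cst t s 1) fa)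
  (is_derive_mul (is_derive_cst (1 - t) s 1) gb)) (is_derive_opp hk))).
by rewrite /=; ring.
Qed.

Lemma is_derive_line u v s : is_derive s 1 (fun x => u + x * v) v.
Proof.
have := is_derive_add (is_derive_cst u s 1)
  (is_derive_mul (is_derive_id s 1) (is_derive_cst v s 1)).
by rewrite mulr0 !add0r mulr1.
Qed.

Lemma is_derive_comp_line f u v s a : is_derive (u + s * v) 1 f a ->
  is_derive s 1 (fun x => f (u + x * v)) (a * v).
Proof.
by move=> fa; apply: is_derive1_comp; exact: is_derive_line.
Qed.

Lemma is_derive_continuous f x a : is_derive x 1 f a -> {for x, continuous f}.
Proof. by move=> [df _]; exact/differentiable_continuous/derivable1_diffP. Qed.

Lemma mean_value f (df : R -> R) a b : a < b ->
  (forall x, a <= x <= b -> is_derive x 1 f (df x)) ->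
  exists2 c, a < c < b & f b - f a = df c * (b - a).
Proof.
move=> ab fdf; case: (@MVT R f df a b ab) => [x||c cab fE].
- by rewrite in_itv/= => /andP[ax xb]; apply: fdf; rewrite !ltW.
- apply: derivable_within_continuous => x; rewrite in_itv/= => xab.
  by have [] := fdf _ xab.
- by exists c => //; move: cab; rewrite in_itv.
Qed.

(** The right difference quotients [f x / x] are nonnegative. The sign condition is one-sided
    because the defects below are controlled for small positive parameters. *)
Lemma derive_right_ge0 f a (e : R) : 0 < e -> is_derive (0 : R) 1 f a -> f 0 = 0 ->
  (forall x, 0 < x < e -> 0 <= f x) -> 0 <= a.
Proof.
move=> e0 [df <-] f0 fge0.
rewrite ['D_1 f 0]cvg_at_rightE//.
apply: limr_ge.
  (* Right neighbourhoods of 0 refine the deleted ones, so the right quotient converges as the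
     two-sided one does. *)
  rewrite -(cvg_at_rightE (fun h : R => h^-1 *: ((f \o shift 0) _ - f 0))) //.
  apply: cvg_trans df; apply: cvg_app.
  move=> A [d dgt0 Ae]; exists d => // x xe xgt0; apply: Ae => //.
  exact/lt0r_neq0.
near=> h; rewrite f0 subr0 /=; apply: mulr_ge0.
  by rewrite invr_ge0; apply: ltW; near: h; exists 1 => /=.
rewrite [_%:A]mulr1 addr0; apply: fge0; apply/andP; split.
  by near: h; exists 1 => /=.
near: h; exists e => //= h; rewrite /ball_ /= sub0r normrN => he _.
exact: le_lt_trans (ler_norm _) he.
Unshelve. all: by end_near. Qed.

(** Taylor's formula at order two: the mean value theorem applied twice gives
    [h 1 = h1 c = h2 d * c] with 0 < d < c < 1. *)
Lemma second_order_ge0 (h h1 h2 : R -> R) :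
  (forall s, 0 <= s <= 1 -> is_derive s 1 h (h1 s)) ->
  (forall s, 0 <= s <= 1 -> is_derive s 1 h1 (h2 s)) ->
  (forall s, 0 <= s <= 1 -> 0 <= h2 s) -> h 0 = 0 -> h1 0 = 0 -> 0 <= h 1.
Proof.
move=> dh dh1 h2_ge0 h00 h10.
have [c /andP[c0 c1]] := mean_value ltr01 dh.
rewrite h00 subr0 subr0 mulr1 => ->.
have [s|d /andP[d0 dc]] := @mean_value h1 h2 0 c c0.
  by move=> /andP[s0 sc]; apply: dh1; rewrite s0 (le_trans sc (ltW c1)).
rewrite h10 !subr0 => ->; apply: mulr_ge0; last exact: ltW.
by apply: h2_ge0; rewrite !ltW// (lt_trans dc).
Qed.

End derivatives.

(** * The transforms A, B and C *)

Section interval.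
Variables (R : realType) (I : set R).
Hypotheses (I_open : open I) (I_itv : is_interval I).

Lemma interval_conv (t x y : R) : 0 <= t <= 1 -> I x -> I y ->
  I (t * x + (1 - t) * y).
Proof.
move=> /andP[t0 t1] Ix Iy; have [xy|/ltW yx] := leP x y.
  by apply: (I_itv Ix Iy); apply/andP; split; nra.
by apply: (I_itv Iy Ix); apply/andP; split; nra.
Qed.

Lemma interval_line (s u v : R) : 0 <= s <= 1 -> I u -> I (u + v) ->
  I (u + s * v).
Proof.
move=> s01 Iu Iuv.
by have -> : u + s * v = s * (u + v) + (1 - s) * u by [ring]; exact: interval_conv.
Qed.

Lemma open_line (u v : R) : I u ->
  exists2 d : R, 0 < d & forall e : R, 0 <= e < d -> I (u + e * v).
Proof.
move=> Iu.
have : \forall e \near (0 : R), I (u + e * v).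
  have cl : {for (0 : R), continuous (fun e : R => u + e * v)}.
    exact: is_derive_continuous (is_derive_line u v 0).
  by apply: cl; apply: open_nbhs_nbhs; split; rewrite //= mul0r addr0.
move=> /nbhs_ballP[d /= d0 dI]; exists d => // e /andP[e0 ed]; apply: dI.
by rewrite /ball /= sub0r normrN ger0_norm.
Qed.

End interval.

Section transforms.
Variables (R : realType) (I : set R) (Phi : R -> R).
Hypotheses (I_open : open I) (I_itv : is_interval I) (Phi_smooth : smooth_on I Phi).

Local Notation Phi1 := (Phi^`())%classic.
Local Notation Phi2 := (Phi^`(2))%classic.
Implicit Types (s t u v e : R).

Lemma smooth_is_derive u : I u -> is_derive u 1 Phi (Phi1 u).
Proof.
by move=> Iu; rewrite derive1E; apply: derivableP; exact: (Phi_smooth (n := 0)).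
Qed.

Lemma smooth_is_derive1 u : I u -> is_derive u 1 Phi1 (Phi2 u).
Proof.
move=> Iu; have := derivableP (Phi_smooth (n := 1) Iu).
by rewrite -derive1E.
Qed.

Lemma transA_derive s u v : I (u + s * v) ->
  is_derive s 1 (fun x => transA Phi (u, x * v)) ((Phi1 (u + s * v) - Phi1 u) * v).
Proof.
move=> Iusv.
have -> : (fun x => transA Phi (u, x * v)) =
    (fun x => Phi (u + x * v) - (Phi u + x * (Phi1 u * v))).
  apply/funext => x; rewrite /transA /=; ring.
apply: (is_derive_eq (is_derive_add (is_derive_comp_line (smooth_is_derive Iusv))
  (is_derive_opp (is_derive_line (Phi u) (Phi1 u * v) s)))).
by ring.
Qed.

Lemma transB_derive s u v : I (u + s * v) ->
  is_derive s 1 (fun x => (Phi1 (u + x * v) - Phi1 u) * v)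
    (transC Phi (u + s * v, v)).
Proof.
move=> Iusv.
apply: (is_derive_eq (is_derive_mul
  (is_derive_add (is_derive_comp_line (smooth_is_derive1 Iusv))
    (is_derive_cst (- Phi1 u) s 1)) (is_derive_cst v s 1))).
by rewrite /transC /=; ring.
Qed.

(** With weight [s] on [u + v], the gap is the chord of [Phi] minus [Phi (u + s * v)]; at 0 the two
    slopes are [Phi (u + v) - Phi u] and [Phi1 u * v]. *)
Lemma jensen_gap_derive u v : I u ->
  is_derive (0 : R) 1 (fun s => jensen_gap Phi s (u + v, u)) (transA Phi (u, v)).
Proof.
move=> Iu.
have -> : (fun s => jensen_gap Phi s (u + v, u)) =
    (fun s => (Phi u + s * (Phi (u + v) - Phi u)) - Phi (u + s * v)).
  apply/funext => x; rewrite /jensen_gap /=.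
  have -> : x * (u + v) + (1 - x) * u = u + x * v by ring.
  by ring.
have Iu0 : I (u + 0 * v) by rewrite mul0r addr0.
apply: (is_derive_eq (is_derive_add (is_derive_line (Phi u) (Phi (u + v) - Phi u) 0)
  (is_derive_opp (is_derive_comp_line (smooth_is_derive Iu0))))).
by rewrite /transA /= mul0r addr0; ring.
Qed.

(** All gaps vanish at weight 0, so their defect [K] starts at 0 and stays nonnegative; its slope at
    0 is the defect of A. *)
Lemma convex_transA_of_gap :
  (forall t, 0 <= t <= 1 ->
    convex_function (E := (R^o * R^o)%type) (I `*` I) (jensen_gap Phi t)) ->
  convex_function (E := (R^o * R^o)%type) (domT I) (transA Phi).
Proof.
move=> cJ; apply/convex_function2P => t u0 v0 u1 v1 t01.
move=> [/= Iu0 Iuv0] [/= Iu1 Iuv1]; rewrite -subr_ge0.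
pose u := t * u0 + (1 - t) * u1; pose v := t * v0 + (1 - t) * v1.
have Iu : I u by exact: interval_conv.
pose K s := t * jensen_gap Phi s (u0 + v0, u0)
  + (1 - t) * jensen_gap Phi s (u1 + v1, u1) - jensen_gap Phi s (u + v, u).
have dK : is_derive (0 : R) 1 K (t * transA Phi (u0, v0) +
    (1 - t) * transA Phi (u1, v1) - transA Phi (u, v)).
  exact: is_derive_conv_sub (jensen_gap_derive v0 Iu0)
    (jensen_gap_derive v1 Iu1) (jensen_gap_derive v Iu).
apply: (derive_right_ge0 ltr01 dK).
  have J0 a b : jensen_gap Phi 0 (a, b) = 0.
    by rewrite /jensen_gap /= !mul0r !subr0 !mul1r !add0r subrr.
  by rewrite /K !J0; ring.
move=> s /andP[s0 s1]; rewrite subr_ge0.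
have s01 : 0 <= s <= 1 by rewrite !ltW.
have -> : u + v = t * (u0 + v0) + (1 - t) * (u1 + v1) by rewrite /u /v; ring.
by have /convex_function2P := cJ s s01; apply.
Qed.

(** The linear involution sending (u, v) to (u + v, - v) preserves [domT], so B is a sum of two
    convex functions. *)
Lemma convex_transB_of_transA :
  convex_function (E := (R^o * R^o)%type) (domT I) (transA Phi) ->
  convex_function (E := (R^o * R^o)%type) (domT I) (transB Phi).
Proof.
move=> /convex_function2P cA; apply/convex_function2P.
move=> t u0 v0 u1 v1 t01 [/= Iu0 Iuv0] [/= Iu1 Iuv1].
have BE u v : transB Phi (u, v) = transA Phi (u, v) + transA Phi (u + v, - v).
  by rewrite /transB /transA /= addrK; ring.
have cA0 := cA t u0 v0 u1 v1 t01 (conj Iu0 Iuv0) (conj Iu1 Iuv1).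
have := cA t (u0 + v0) (- v0) (u1 + v1) (- v1) t01.
rewrite /domT /= !addrK => /(_ (conj Iuv0 Iu0) (conj Iuv1 Iu1)).
have -> : t * (u0 + v0) + (1 - t) * (u1 + v1) =
  t * u0 + (1 - t) * u1 + (t * v0 + (1 - t) * v1) by ring.
have -> : t * (- v0) + (1 - t) * (- v1) = - (t * v0 + (1 - t) * v1) by ring.
by rewrite !BE; lra.
Qed.

(** The vector v is a difference of two points of [I], so v + [I] meets [I] whatever the base point
    on the segment. *)
Lemma domT'_line s u v : 0 <= s <= 1 -> I u -> I (u + v) -> domT' I (u + s * v, v).
Proof.
move=> s01 Iu Iuv; split=> /=; first exact: interval_line.
by exists (v + u); split; [exists u|rewrite addrC].
Qed.

Lemma convex_transC_of_transB :
  convex_function (E := (R^o * R^o)%type) (domT I) (transB Phi) ->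
  convex_function (E := (R^o * R^o)%type) (domT' I) (transC Phi).
Proof.
move=> /convex_function2P cB; apply/convex_function2P.
move=> t u0 v0 u1 v1 t01 [/= Iu0 _] [/= Iu1 _]; rewrite -subr_ge0.
pose u := t * u0 + (1 - t) * u1; pose v := t * v0 + (1 - t) * v1.
have Iu : I u by exact: interval_conv.
(* A point (u, v) of [domT'] may have u + v outside [I]; shrinking v brings it into the domain of
   B. *)
have [d0 d0_gt0 Id0] := open_line I_open v0 Iu0.
have [d1 d1_gt0 Id1] := open_line I_open v1 Iu1.
(* [D a b e] is B(a, e b) / e. It vanishes at e = 0 with slope C(a, b), so a single division by e
   turns the second-order limit into a first derivative. *)
pose D (a b e : R) : R := (Phi1 (a + e * b) - Phi1 a) * b.
have dD a b : I a -> is_derive (0 : R) 1 (D a b) (transC Phi (a, b)).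
  move=> Ia; have := @transB_derive 0 a b.
  by rewrite mul0r addr0; apply.
have dK := is_derive_conv_sub t (dD _ v0 Iu0) (dD _ v1 Iu1) (dD _ v Iu).
have d_gt0 : 0 < Num.min d0 d1 by rewrite lt_min d0_gt0.
apply: (derive_right_ge0 d_gt0 dK).
  by rewrite /D !mul0r !addr0 !subrr; ring.
move=> e /andP[e0]; rewrite lt_min => /andP[ed0 ed1].
have Ie0 : I (u0 + e * v0) by apply: Id0; rewrite ltW.
have Ie1 : I (u1 + e * v1) by apply: Id1; rewrite ltW.
have := cB t u0 (e * v0) u1 (e * v1) t01 (conj Iu0 Ie0) (conj Iu1 Ie1).
have -> : t * (e * v0) + (1 - t) * (e * v1) = e * v by rewrite /v; ring.
have BE (a b : R) : transB Phi (a, e * b) = e * D a b e.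
  by rewrite /transB /D /=; ring.
rewrite -/u !BE -subr_ge0 => ge0.
rewrite -(pmulr_rge0 _ e0); apply: le_trans ge0 _.
by rewrite le_eqVlt; apply/orP; left; apply/eqP; ring.
Qed.

(** As [I] is open, equality on [I] is equality near each of its points, so the derivatives agree
    there whatever the extension of [Phi] outside. *)
Lemma affine_derive2 u : affine_on I Phi -> I u -> Phi2 u = 0.
Proof.
move=> [a [b PhiE]] Iu.
have Phi1E x : I x -> Phi1 x = a.
  move=> Ix; have [_ <-] := smooth_is_derive Ix.
  have near_eq : \near x, b + x * a = Phi x.
    have : \forall y \near x, I y by apply: open_nbhs_nbhs.
    by apply: filterS => y Iy; rewrite PhiE// addrC mulrC.
  have [_ <-] := is_derive_line b a x.
  by apply/esym/near_eq_derive.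
have [_ <-] := smooth_is_derive1 Iu.
have near_eq : \near u, cst a u = Phi1 u.
  have : \forall y \near u, I y by apply: open_nbhs_nbhs.
  by apply: filterS => y Iy; rewrite Phi1E.
have [_ <-] := is_derive_cst a u (1 : R).
by apply/esym/near_eq_derive.
Qed.

Lemma derive0_interval (f df : R -> R) :
  (forall x, I x -> is_derive x 1 f (df x)) -> (forall x, I x -> df x = 0) ->
  forall x y, I x -> I y -> f x = f y.
Proof.
move=> fdf df0; wlog xy : / forall x y, I x -> I y -> x < y -> f x = f y.
  apply=> x y Ix Iy xy.
  have Ic c : x <= c <= y -> I c by exact: I_itv.
  have [c Hc|c /andP[xc cy] /eqP] := @mean_value _ f df x y xy.
    by apply: fdf; exact: Ic.
  by rewrite df0 ?mul0r ?subr_eq0; [move=> /eqP|apply: Ic; rewrite !ltW].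
move=> x y Ix Iy; have [/xy->//|/xy->//|->//] := ltgtP x y.
Qed.

Lemma affine_of_derive2 : (forall u, I u -> Phi2 u = 0) -> affine_on I Phi.
Proof.
move=> Phi20; have [[u Iu]|nI] := pselect (exists u, I u); last first.
  by exists 0, 0 => x Ix; exfalso; apply: nI; exists x.
have Phi1E x : I x -> Phi1 x = Phi1 u.
  by move=> Ix; apply: (derive0_interval smooth_is_derive1).
(* [Phi] minus the line of slope [Phi1 u] has zero derivative on [I]; its constant value, read at
   the base point [u], is the intercept. *)
exists (Phi1 u), (Phi u - Phi1 u * u) => x Ix.
have dg y : I y ->
    is_derive y 1 (fun z => Phi z - (0 + z * Phi1 u)) (Phi1 y - Phi1 u).
  move=> Iy; exact: (is_derive_add (smooth_is_derive Iy)
    (is_derive_opp (is_derive_line 0 (Phi1 u) y))).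
have := derive0_interval dg _ Ix Iu.
rewrite !add0r => H.
have E : Phi x - x * Phi1 u = Phi u - u * Phi1 u.
  by apply: H => y Iy; rewrite Phi1E// subrr.
have -> : Phi x = (Phi x - x * Phi1 u) + x * Phi1 u by ring.
by rewrite E; ring.
Qed.

End transforms.

(** * Inequalities between the quadratic form C and the inverse of the second derivative *)

Lemma neg_inv_le_conv (R : realFieldType) (t e p p0 p1 : R) :
  0 <= t <= 1 -> 0 < e -> 0 < p -> 0 < p0 -> 0 < p1 ->
  p * (t * (e / p0) + (1 - t) * (e / p1)) ^+ 2 <=
    t * (p0 * (e / p0) ^+ 2) + (1 - t) * (p1 * (e / p1) ^+ 2) ->
  - 1 / p <= t * (- 1 / p0) + (1 - t) * (- 1 / p1).
Proof.
move=> /andP[t0 t1] e_gt0 p_gt0 p0_gt0 p1_gt0.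
(* [S] averages 1 / p0 and 1 / p1. The factor e ^ 2 cancels and the hypothesis becomes p S ^ 2 <= S,
   that is S <= 1 / p since S > 0. *)
pose S := t / p0 + (1 - t) / p1.
have -> : t * (e / p0) + (1 - t) * (e / p1) = e * S by rewrite /S; ring.
have -> : t * (p0 * (e / p0) ^+ 2) + (1 - t) * (p1 * (e / p1) ^+ 2)
  = e ^+ 2 * S by rewrite /S; field; rewrite !gt_eqF.
have -> : p * (e * S) ^+ 2 = e ^+ 2 * (p * S ^+ 2) by ring.
rewrite ler_pM2l ?exprn_gt0// => pS.
have -> : t * (- 1 / p0) + (1 - t) * (- 1 / p1) = - S by rewrite /S; ring.
rewrite mulN1r lerN2.
have S0 : 0 < S.
  rewrite /S; have [->|tneq0] := eqVneq t 0.
    by rewrite mul0r add0r subr0 divr_gt0.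
  apply: ltr_pwDl; first by rewrite divr_gt0// lt_neqAle eq_sym tneq0.
  by rewrite divr_ge0 ?subr_ge0// ltW.
rewrite -[p^-1]mul1r ler_pdivlMr// -(ler_pM2l S0) mulr1.
by apply: le_trans pS; rewrite le_eqVlt; apply/orP; left; apply/eqP; ring.
Qed.

(** The hypothesis says p S <= 1, with S the average of the inverses. Writing v_i as the product of
    p_i ^ (-1/2) and p_i ^ (1/2) v_i bounds the squared average of the v_i by S X. *)
Lemma sqr_le_conv_neg_inv (R : realFieldType) (t p p0 p1 v0 v1 : R) :
  0 <= t <= 1 -> 0 < p -> 0 < p0 -> 0 < p1 ->
  - 1 / p <= t * (- 1 / p0) + (1 - t) * (- 1 / p1) ->
  p * (t * v0 + (1 - t) * v1) ^+ 2 <=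
    t * (p0 * v0 ^+ 2) + (1 - t) * (p1 * v1 ^+ 2).
Proof.
move=> /andP[t0 t1] p_gt0 p0_gt0 p1_gt0.
pose S := t / p0 + (1 - t) / p1.
have -> : t * (- 1 / p0) + (1 - t) * (- 1 / p1) = - S by rewrite /S; ring.
rewrite mulN1r lerN2 -[p^-1]mul1r ler_pdivlMr// => Sp1.
pose X := t * (p0 * v0 ^+ 2) + (1 - t) * (p1 * v1 ^+ 2).
have X0 : 0 <= X.
  by rewrite addr_ge0// mulr_ge0 ?subr_ge0// mulr_ge0 ?sqr_ge0// ltW.
(* Cauchy-Schwarz *)
have CS : (t * v0 + (1 - t) * v1) ^+ 2 <= S * X.
  rewrite -subr_ge0.
  have -> : S * X - (t * v0 + (1 - t) * v1) ^+ 2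
      = t * (1 - t) / (p0 * p1) * (p1 * v1 - p0 * v0) ^+ 2.
    by rewrite /S /X; field; rewrite !gt_eqF.
  by rewrite mulr_ge0 ?sqr_ge0// divr_ge0 ?mulr_ge0 ?subr_ge0// ltW.
apply: (@le_trans _ _ (p * (S * X))); first by rewrite ler_pM2l.
by rewrite mulrA [p * S]mulrC -/X ler_piMl.
Qed.

(** * Consequences of the convexity of C, and the tangent plane of A *)

Section convexity.
Variables (R : realType) (I : set R) (Phi : R -> R).
Hypotheses (I_open : open I) (I_itv : is_interval I) (Phi_smooth : smooth_on I Phi).

Local Notation Phi1 := (Phi^`())%classic.
Local Notation Phi2 := (Phi^`(2))%classic.
Implicit Types (s t u v d e : R).

Lemma domT'_small u v : I u -> exists2 d : R, 0 < d &
  forall e : R, 0 <= e < d -> domT' I (u, e * v).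
Proof.
move=> Iu; have [d d0 dI] := open_line I_open v Iu.
exists d => // e ed; split=> //=.
by exists (e * v + u); split; [exists u|rewrite addrC; exact: dI].
Qed.

Lemma common_radius d d' : 0 < d -> 0 < d' ->
  exists2 e, 0 < e & 0 <= e < d /\ 0 <= e < d'.
Proof.
move=> d0 d'0; have m0 : 0 < Num.min d d' by rewrite lt_min d0.
exists (Num.min d d' / 2); first by rewrite divr_gt0.
have := gtr_pMr (2^-1) m0; rewrite invf_lt1 ?ltr1n// lt_min => /andP[-> ->].
by rewrite divr_ge0// ltW.
Qed.

Section necessary.
Hypothesis convex_transC :
  convex_function (E := (R^o * R^o)%type) (domT' I) (transC Phi).

Let convC t u0 v0 u1 v1 : 0 <= t <= 1 -> domT' I (u0, v0) -> domT' I (u1, v1) ->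
  Phi2 (t * u0 + (1 - t) * u1) * (t * v0 + (1 - t) * v1) ^+ 2 <=
  t * (Phi2 u0 * v0 ^+ 2) + (1 - t) * (Phi2 u1 * v1 ^+ 2).
Proof. by have /convex_function2P := convex_transC; apply. Qed.

(** The opposite vectors e and - e over the same point u have midpoint 0, where C vanishes; the
    average of their values is phi(u) e ^ 2. *)
Lemma derive2_ge0 u : I u -> 0 <= Phi2 u.
Proof.
move=> Iu; have [d d0 dI] := domT'_small 1 Iu.
have [d' d'0 dI'] := domT'_small (-1) Iu.
have [e e0 [ed ed']] := common_radius d0 d'0.
have half : 0 <= (2^-1 : R) <= 1 by apply/andP; split; lra.
have := convC half (dI e ed) (dI' e ed').
have -> : 2^-1 * u + (1 - 2^-1) * u = u by field.
have -> : 2^-1 * (e * 1) + (1 - 2^-1) * (e * -1) = 0 by field.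
have -> : 2^-1 * (Phi2 u * (e * 1) ^+ 2) + (1 - 2^-1) * (Phi2 u * (e * -1) ^+ 2)
  = Phi2 u * e ^+ 2 by field.
by rewrite expr0n mulr0 pmulr_lge0// exprn_gt0.
Qed.

(** Take the vector a over u0 and the vector 0 over a point beyond u, seen from u0. C vanishes at
    both, while the convex combination over u carries the nonzero vector l a, so phi(u) <= 0. *)
Lemma derive2_eq0 u0 u : I u0 -> Phi2 u0 = 0 -> I u -> Phi2 u = 0.
Proof.
move=> Iu0 Phi20 Iu.
have [d d0 dI] := open_line I_open (u - u0) Iu.
have [d' d'0 dI'] := domT'_small 1 Iu0.
(* The weight [l] solves l u0 + (1 - l) (u + e (u - u0)) = u. *)
pose e := d / 2; pose a := d' / 2; pose l := e / (1 + e).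
have e0 : 0 < e by rewrite divr_gt0.
have a0 : 0 < a by rewrite divr_gt0.
have ed : 0 <= e < d by rewrite ltW//= /e; lra.
have ad : 0 <= a < d' by rewrite ltW//= /a; lra.
have l0 : 0 < l by rewrite divr_gt0// addr_gt0.
have l1 : l <= 1 by rewrite ler_pdivrMr ?addr_gt0//; lra.
have Ie := dI e ed.
have T1 : domT' I (u + e * (u - u0), 0).
  split=> //=; exists (u + e * (u - u0)); split=> //.
  by exists (u + e * (u - u0)); rewrite ?add0r.
have l01 : 0 <= l <= 1 by rewrite ltW.
have := convC l01 (dI' a ad) T1.
have -> : l * u0 + (1 - l) * (u + e * (u - u0)) = u.
  rewrite /l; field; lra.
set w := Phi2 (u + _).
have -> : l * (Phi2 u0 * (a * 1) ^+ 2) + (1 - l) * (w * 0 ^+ 2) = 0.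
  by rewrite Phi20; ring.
have -> : l * (a * 1) + (1 - l) * 0 = l * a by ring.
move=> le0.
apply/eqP; rewrite eq_le derive2_ge0// andbT.
by rewrite -(pmulr_lle0 _ (_ : 0 < (l * a) ^+ 2))// exprn_gt0// mulr_gt0.
Qed.

(** One zero of phi forces phi = 0 on all of [I]; otherwise phi is positive everywhere and can be
    inverted. *)
Lemma affine_or_convex_inv : affine_on I Phi \/
  ((forall x, I x -> 0 < Phi2 x) /\
   convex_function (E := R^o) I (fun x => - 1 / Phi2 x)).
Proof.
have [[u0 [Iu0 Phi20]]|nz] := pselect (exists u, I u /\ Phi2 u = 0).
  left; apply: (affine_of_derive2 I_itv Phi_smooth) => u.
  exact: (derive2_eq0 Iu0).
right.
have pos u : I u -> 0 < Phi2 u.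
  move=> Iu; rewrite lt_neqAle derive2_ge0// andbT eq_sym.
  by apply/eqP => Phi20; apply: nz; exists u.
split=> //; apply/convex_function1P => t u0 u1 t01 Iu0 Iu1.
have Iu : I (t * u0 + (1 - t) * u1) by exact: interval_conv.
have p0 := pos _ Iu0; have p1 := pos _ Iu1; have p := pos _ Iu.
(* Vectors proportional to 1 / phi(u_i) are the equality case of Cauchy-Schwarz; a common small
   scale e keeps both points in [domT']. *)
have [d d0 dI] := domT'_small (Phi2 u0)^-1 Iu0.
have [d' d'0 dI'] := domT'_small (Phi2 u1)^-1 Iu1.
have [e e0 [ed ed']] := common_radius d0 d'0.
have := convC t01 (dI e ed) (dI' e ed').
exact: (neg_inv_le_conv t01 e0 p p0 p1).
Qed.

(** Along s, A(u, s v) vanishes to first order at 0 and its second derivative is a value of C,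
    nonnegative as phi is. This puts [Phi] above its tangents. *)
Lemma transA_ge0 u v : I u -> I (u + v) -> 0 <= transA Phi (u, v).
Proof.
move=> Iu Iuv; rewrite -[v]mul1r.
have Is s : 0 <= s <= 1 -> I (u + s * v) by move=> s01; exact: interval_line.
apply: (@second_order_ge0 _ (fun s => transA Phi (u, s * v))) => [s s01|s s01|s s01||].
- by apply: (transA_derive Phi_smooth); exact: Is.
- by apply: (transB_derive Phi_smooth); exact: Is.
- by rewrite /transC /= mulr_ge0 ?derive2_ge0 ?sqr_ge0//; exact: Is.
- by rewrite /transA /= mul0r addr0 subrr mulr0 subrr.
- by rewrite /= mul0r addr0 subrr mul0r.
Qed.

(** In the average of the tangent inequalities at the barycentre [m], the linear terms cancel. *)
Lemma convex_Phi : convex_function (E := R^o) I Phi.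
Proof.
apply/convex_function1P => t x y t01 Ix Iy; case/andP: (t01) => t0 t1.
set m := t * x + (1 - t) * y.
have Im : I m by exact: interval_conv.
have := @transA_ge0 m (x - m) Im; have := @transA_ge0 m (y - m) Im.
rewrite /transA /= !subrKC => /(_ Iy) H0 /(_ Ix) H1.
have {}H0 : 0 <= (1 - t) * (Phi y - Phi m - Phi1 m * (y - m)).
  by rewrite mulr_ge0// subr_ge0.
have {}H1 : 0 <= t * (Phi x - Phi m - Phi1 m * (x - m)).
  by rewrite mulr_ge0.
rewrite -subr_ge0; apply: le_trans (addr_ge0 H1 H0) _.
by rewrite le_eqVlt; apply/orP; left; apply/eqP; rewrite /m; ring.
Qed.

(** With the same vector e over both points, C is phi times the constant e ^ 2. *)
Lemma convex_derive2 : convex_function (E := R^o) I Phi2.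
Proof.
apply/convex_function1P => t u0 u1 t01 Iu0 Iu1.
have [d d0 dI] := domT'_small 1 Iu0.
have [d' d'0 dI'] := domT'_small 1 Iu1.
have [e e0 [ed ed']] := common_radius d0 d'0.
have := convC t01 (dI e ed) (dI' e ed').
have -> : t * (e * 1) + (1 - t) * (e * 1) = e by ring.
move: (Phi2 (t * u0 + _)) (Phi2 u0) (Phi2 u1) => w w0 w1.
have -> : t * (w0 * (e * 1) ^+ 2) + (1 - t) * (w1 * (e * 1) ^+ 2) =
  (t * w0 + (1 - t) * w1) * e ^+ 2 by ring.
by rewrite (ler_pM2r (exprn_gt0 2 e0)).
Qed.

End necessary.

Lemma convex_transC_of_inv : affine_on I Phi \/
  ((forall x, I x -> 0 < Phi2 x) /\
   convex_function (E := R^o) I (fun x => - 1 / Phi2 x)) ->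
  convex_function (E := (R^o * R^o)%type) (domT' I) (transC Phi).
Proof.
move=> H; apply/convex_function2P => t u0 v0 u1 v1 t01 [/= Iu0 _] [/= Iu1 _].
have Iu : I (t * u0 + (1 - t) * u1) by exact: interval_conv.
case: H => [aff|[pos /convex_function1P cinv]].
  have C0 u v : I u -> transC Phi (u, v) = 0.
    move=> Iu'; rewrite /transC; have -> := affine_derive2 I_open Phi_smooth aff Iu'.
    by rewrite mul0r.
  by rewrite !C0// !mulr0 addr0.
exact: (sqr_le_conv_neg_inv v0 v1 t01 (pos _ Iu) (pos _ Iu0) (pos _ Iu1)
  (cinv t u0 u1 t01 Iu0 Iu1)).
Qed.

Lemma convex_transA_of_transC :
  convex_function (E := (R^o * R^o)%type) (domT' I) (transC Phi) ->
  convex_function (E := (R^o * R^o)%type) (domT I) (transA Phi).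
Proof.
move=> /convex_function2P cC; apply/convex_function2P.
move=> t u0 v0 u1 v1 t01 [/= Iu0 Iuv0] [/= Iu1 Iuv1]; rewrite -subr_ge0.
pose u := t * u0 + (1 - t) * u1; pose v := t * v0 + (1 - t) * v1.
have Iu : I u by exact: interval_conv.
have Iuv : I (u + v).
  have -> : u + v = t * (u0 + v0) + (1 - t) * (u1 + v1) by rewrite /u /v; ring.
  exact: interval_conv.
have Is x y s : I x -> I (x + y) -> 0 <= s <= 1 -> I (x + s * y).
  by move=> ? ? ?; exact: interval_line.
pose h s := t * transA Phi (u0, s * v0) + (1 - t) * transA Phi (u1, s * v1)
  - transA Phi (u, s * v).
have -> : t * transA Phi (u0, v0) + (1 - t) * transA Phi (u1, v1)
  - transA Phi (u, v) = h 1 by rewrite /h !mul1r.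
pose D (a b s : R) : R := (Phi1 (a + s * b) - Phi1 a) * b.
(* The base points u_i + s v_i move while the vectors v_i stay fixed, so the second derivative of
   [h] is a defect of C at each s. *)
apply: (@second_order_ge0 _ h (fun s => t * D u0 v0 s + (1 - t) * D u1 v1 s - D u v s)
  (fun s => t * transC Phi (u0 + s * v0, v0) +
    (1 - t) * transC Phi (u1 + s * v1, v1) - transC Phi (u + s * v, v)))
  => [s s01|s s01|s s01||].
- by apply: is_derive_conv_sub; apply: (transA_derive Phi_smooth); exact: Is.
- by apply: is_derive_conv_sub; apply: (transB_derive Phi_smooth); exact: Is.
- have -> : u + s * v = t * (u0 + s * v0) + (1 - t) * (u1 + s * v1).
    by rewrite /u /v; ring.
  by rewrite subr_ge0; apply: cC => //; exact: domT'_line.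
- have A0 a : transA Phi (a, 0) = 0.
    by rewrite /transA /= addr0 subrr mulr0 subrr.
  by rewrite /h !mul0r !A0; ring.
- by rewrite /D !mul0r !addr0 !subrr; ring.
Qed.

(** The two coefficients are the partial derivatives of A at (u0, v0). A convex function lies above
    its tangent plane; restricting to the segment towards (u, v) leaves a derivative in one
    variable. *)
Lemma transA_tangent u0 v0 u v :
  convex_function (E := (R^o * R^o)%type) (domT I) (transA Phi) ->
  domT I (u0, v0) -> domT I (u, v) ->
  transA Phi (u0, v0)
    + (Phi1 (u0 + v0) - Phi1 u0 - Phi2 u0 * v0) * (u - u0)
    + (Phi1 (u0 + v0) - Phi1 u0) * (v - v0) <= transA Phi (u, v).
Proof.
move=> /convex_function2P cA T0 T1; have [/= Iu0 Iuv0] := T0.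
pose a := u - u0; pose b := v - v0; rewrite -/a -/b.
pose L := (Phi1 (u0 + v0) - Phi1 u0 - Phi2 u0 * v0) * a
  + (Phi1 (u0 + v0) - Phi1 u0) * b.
pose f s := transA Phi (u0 + s * a, v0 + s * b).
have df : is_derive (0 : R) 1 f L.
  have fE : f = fun s => Phi (u0 + v0 + s * (a + b)) - (Phi (u0 + s * a)
      + Phi1 (u0 + s * a) * (v0 + s * b)).
    apply/funext => s; rewrite /f /transA /=.
    have -> : u0 + s * a + (v0 + s * b) = u0 + v0 + s * (a + b) by ring.
    by ring.
  have I0 : I (u0 + 0 * a) by rewrite mul0r addr0.
  have I1 : I (u0 + v0 + 0 * (a + b)) by rewrite mul0r addr0.
  rewrite fE.
  apply: (is_derive_eq (is_derive_add
    (is_derive_comp_line (smooth_is_derive Phi_smooth I1))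
    (is_derive_opp (is_derive_add
      (is_derive_comp_line (smooth_is_derive Phi_smooth I0))
      (is_derive_mul (is_derive_comp_line (smooth_is_derive1 Phi_smooth I0))
        (is_derive_line v0 b 0)))))).
  by rewrite /L /= !mul0r !addr0; ring.
have f0 : f 0 = transA Phi (u0, v0) by rewrite /f !mul0r !addr0.
have f1 : f 1 = transA Phi (u, v).
  by rewrite /f !mul1r /a /b !subrKC.
(* Chord minus function: zero at s = 0 and nonnegative on the segment by convexity. *)
have dK : is_derive (0 : R) 1 (fun s => (f 0 + s * (f 1 - f 0)) - f s)
    (f 1 - f 0 - L).
  exact: (is_derive_add (is_derive_line (f 0) (f 1 - f 0) 0) (is_derive_opp df)).
rewrite -addrA -/L -f0 -f1 -subr_ge0 opprD addrA.
apply: (derive_right_ge0 ltr01 dK); first by rewrite mul0r addr0 subrr.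
move=> s /andP[s0 s1]; rewrite subr_ge0.
have s01 : 0 <= s <= 1 by rewrite !ltW.
have := cA s u v u0 v0 s01 T1 T0.
have -> : s * u + (1 - s) * u0 = u0 + s * a by rewrite /a; ring.
have -> : s * v + (1 - s) * v0 = v0 + s * b by rewrite /b; ring.
rewrite -/(f s) -f0 -f1 => /le_trans; apply.
by rewrite le_eqVlt; apply/orP; left; apply/eqP; ring.
Qed.

End convexity.

(** * Bounded measurable functions *)

(** This is the integrability condition carried through the means below: it implies integrability
    under a probability and is stable under sums, products, sections and partial means. *)
Definition bounded_measurable (R : realType) d (T : measurableType d)
    (f : T -> R) : Prop :=
  measurable_fun setT f /\ exists M, forall x, `|f x| <= M.

Section bounded_measurable.
Context (R : realType) d (T : measurableType d).
Implicit Types f g : T -> R.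

Lemma bm_cst (a : R) : bounded_measurable (fun _ : T => a).
Proof. by split; [exact: measurable_cst|exists `|a|]. Qed.

Lemma bm_add f g : bounded_measurable f -> bounded_measurable g ->
  bounded_measurable (fun x => f x + g x).
Proof.
move=> [mf [M fM]] [mg [N gN]]; split; first exact: measurable_funD.
by exists (M + N) => x; rewrite (le_trans (ler_normD _ _))// lerD.
Qed.

Lemma bm_mul f g : bounded_measurable f -> bounded_measurable g ->
  bounded_measurable (fun x => f x * g x).
Proof.
move=> [mf [M fM]] [mg [N gN]]; split; first exact: measurable_funM.
by exists (M * N) => x; rewrite normrM ler_pM.
Qed.

Lemma bm_opp f : bounded_measurable f -> bounded_measurable (fun x => - f x).
Proof.
move=> [mf [M fM]]; split; first exact: measurableT_comp.
by exists M => x; rewrite normrN.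
Qed.

Lemma bm_sub f g : bounded_measurable f -> bounded_measurable g ->
  bounded_measurable (fun x => f x - g x).
Proof. by move=> bf bg; apply: bm_add => //; exact: bm_opp. Qed.

Lemma bm_comp d' (S : measurableType d') (h : S -> T) f :
  measurable_fun setT h -> bounded_measurable f ->
  bounded_measurable (fun x => f (h x)).
Proof.
move=> mh [mf [M fM]]; split; first exact: measurableT_comp.
by exists M => x; exact: fM.
Qed.

Lemma bm_indic (A : set T) : measurable A ->
  bounded_measurable (\1_A : T -> R).
Proof.
move=> mA; split; first exact: measurable_indic.
by exists 1 => x; rewrite indicE; case: (_ \in _); rewrite ?normr1 ?normr0.
Qed.

End bounded_measurable.

(** * Means of bounded measurable functions *)

Section mean.
Context (R : realType) (E : probSpace R).
Implicit Types f g : E -> R.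

Lemma bm_integrable f : bounded_measurable f ->
  (ps_prob E).-integrable setT (EFin \o f).
Proof.
move=> [mf [M fM]]; apply: measurable_bounded_integrable => //.
  exact: fin_num_fun_lty.
exists M; split; first exact: num_real.
by move=> N MN x _ /=; rewrite (le_trans (fM x))// ltW.
Qed.

Lemma eq_mean f g : f =1 g -> mean f = mean g.
Proof. by move=> fg; congr mean; apply/funext. Qed.

Lemma mean_cst (a : R) : mean (fun _ : E => a) = a.
Proof.
have PT1 : fine (ps_prob E setT) = 1 by rewrite probability_setT.
by rewrite /mean Rintegral_cst// PT1 mulr1.
Qed.

Lemma meanD f g : bounded_measurable f -> bounded_measurable g ->
  mean (fun x => f x + g x) = mean f + mean g.
Proof. by move=> bf bg; rewrite /mean RintegralD//; exact: bm_integrable. Qed.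

Lemma meanB f g : bounded_measurable f -> bounded_measurable g ->
  mean (fun x => f x - g x) = mean f - mean g.
Proof. by move=> bf bg; rewrite /mean RintegralB//; exact: bm_integrable. Qed.

Lemma meanZ (a : R) f : bounded_measurable f ->
  mean (fun x => a * f x) = a * mean f.
Proof. by move=> bf; rewrite /mean RintegralZl//; exact: bm_integrable. Qed.

Lemma le_mean f g : bounded_measurable f -> bounded_measurable g ->
  (forall x, f x <= g x) -> mean f <= mean g.
Proof.
by move=> bf bg fg; apply: le_Rintegral => //; exact: bm_integrable.
Qed.

(** [mean] passes through [fine], which sends infinite values to 0; finiteness of the integral makes
    the passage reversible. *)
Lemma EFin_mean f : bounded_measurable f ->
  (mean f)%:E = (\int[ps_prob E]_x (f x)%:E)%E.
Proof.
move=> bf; rewrite /mean /Rintegral fineK//.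
by apply: integrable_fin_num => //; exact: bm_integrable.
Qed.

Lemma norm_mean_le f (M : R) : bounded_measurable f ->
  (forall x, `|f x| <= M) -> `|mean f| <= M.
Proof.
move=> bf fM; rewrite ler_norml; apply/andP; split.
  rewrite -(mean_cst (- M)); apply: le_mean => //; first exact: bm_cst.
  by move=> x; have := fM x; rewrite ler_norml => /andP[].
rewrite -(mean_cst M); apply: le_mean => //; first exact: bm_cst.
by move=> x; have := fM x; rewrite ler_norml => /andP[].
Qed.

Lemma mean_if (A : set E) (c d : R) : measurable A ->
  mean (fun x => if x \in A then c else d) =
  fine (ps_prob E A) * c + (1 - fine (ps_prob E A)) * d.
Proof.
move=> mA.
transitivity (mean (fun x => d + (c - d) * (\1_A : E -> R) x)).
  apply: eq_mean => x; rewrite indicE.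
  by case: (x \in A); rewrite /= ?mulr1 ?mulr0 ?addr0 ?subrKC.
have b1 := bm_indic R mA.
rewrite meanD; [|exact: bm_cst|by apply: bm_mul => //; exact: bm_cst].
have indicE : mean (\1_A : E -> R) = fine (ps_prob E A).
  by rewrite /mean /Rintegral integral_indic// setIT.
by rewrite mean_cst meanZ// indicE; ring.
Qed.

End mean.

(** * Fubini's theorem for means *)

Section fubini.
Context (R : realType) (E F : probSpace R).
Variable f : E * F -> R.
Hypothesis bf : bounded_measurable f.

Lemma bm_section1 x : bounded_measurable (fun y => f (x, y)).
Proof.
apply: (bm_comp (h := fun y => (x, y))) => //.
exact: measurable_fun_pair.
Qed.

Lemma bm_section2 y : bounded_measurable (fun x => f (x, y)).
Proof.
by apply: (bm_comp (h := fun x => (x, y))).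
Qed.

Lemma bm_mean1 : bounded_measurable (fun x => mean (fun y : F => f (x, y))).
Proof.
have [_ [M fM]] := bf; split; last first.
  by exists M => x; apply: norm_mean_le => //; exact: bm_section1.
(* The partial integral is measurable as an extended real, and [fine] preserves measurability. *)
have := @measurable_fubini_F _ _ _ _ _ (ps_prob E) (ps_prob F) (EFin \o f)
  (@bm_integrable R (ps_prod E F) f bf).
move=> /(measurableT_comp (fine_measurable (R := R) measurableT)).
exact.
Qed.

Lemma bm_mean2 : bounded_measurable (fun y => mean (fun x : E => f (x, y))).
Proof.
have [_ [M fM]] := bf; split; last first.
  by exists M => y; apply: norm_mean_le => //; exact: bm_section2.
have := @measurable_fubini_G _ _ _ _ _ (ps_prob E) (ps_prob F) (EFin \o f)
  (@bm_integrable R (ps_prod E F) f bf).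
move=> /(measurableT_comp (fine_measurable (R := R) measurableT)).
exact.
Qed.

Lemma mean_prod1 : mean (f : ps_prod E F -> R) =
  mean (fun x => mean (fun y : F => f (x, y))).
Proof.
rewrite /mean/= /Rintegral /=.
rewrite -(@integral12_prod_meas1 _ _ _ _ _ (ps_prob E) (ps_prob F) (EFin \o f)
  (@bm_integrable R (ps_prod E F) f bf)).
congr fine; apply: eq_integral => x _.
by rewrite /fubini_F /= -EFin_mean//; exact: bm_section1.
Qed.

Lemma mean_prod2 : mean (f : ps_prod E F -> R) =
  mean (fun y => mean (fun x : E => f (x, y))).
Proof.
rewrite /mean/= /Rintegral /=.
rewrite -(@integral21_prod_meas1 _ _ _ _ _ (ps_prob E) (ps_prob F) (EFin \o f)
  (@bm_integrable R (ps_prod E F) f bf)).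
congr fine; apply: eq_integral => x _.
by rewrite /fubini_G /= -EFin_mean//; exact: bm_section2.
Qed.

End fubini.

(** * The class K *)

Section classK.
Variables (R : realType) (I : set R).
Hypotheses (I_open : open I) (I_itv : is_interval I).

(** An empty space would have total mass 0. A point is what makes the range of a function nonempty,
    so that extrema exist. *)
Lemma probSpace_inhabited (E : probSpace R) : exists x : E, True.
Proof.
apply: contrapT => nE.
have E0 : [set: E] = set0 by apply/seteqP; split=> x // _; apply: nE; exists x.
have := probability_setT (ps_prob E).
by rewrite E0 measure0 => /eqP; rewrite eq_sym onee_eq0.
Qed.

(** A nonempty compact closure inside [I] has a least and a greatest element, both in [I];
    conversely a segment with endpoints in [I] is compact and lies in [I]. Two bounds thus replace
    the topology. *)
Lemma classKP (E : probSpace R) (f : E -> R) : classK I E f <->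
  measurable_fun setT f /\ exists a b, [/\ I a, I b & forall x, a <= f x <= b].
Proof.
split=> [[mf]|[mf [a [b [Ia Ib fab]]]]].
  rewrite precompactE => cf fI; split=> //.
  have [x0 _] := probSpace_inhabited E.
  have cl0 : closure (range f) !=set0.
    by exists (f x0); apply: subset_closure; exists x0.
  have cid : {within closure (range f), continuous (@id R)}.
    by apply: continuous_subspaceT => x; exact: cvg_id.
  have [b /set_mem bcl fb] := compact_EVT_max cl0 cf cid.
  have [a /set_mem acl fa] := compact_EVT_min cl0 cf cid.
  exists a, b; split; [exact: fI|exact: fI|move=> x].
  have fx : f x \in closure (range f).
    by apply/mem_set/subset_closure; exists x.
  by apply/andP; split; [exact: fa fx|exact: fb fx].
have sub : range f `<=` `[a, b].
  by move=> _ [x _ <-] /=; rewrite in_itv /=; exact: fab.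
split=> //.
  apply: (precompact_subset sub); apply: compact_precompact.
    exact: Rhausdorff.
  exact: segment_compact.
have ccl := @interval_closed R (BLeft a) (BRight b) isT isT.
move=> y /(closure_subset sub); rewrite -(closure_id _).1//= in_itv/=.
exact: I_itv.
Qed.

(** Measurability comes from continuity on the open set [I], where [f] takes its values; boundedness
    from compactness of a segment of [I] containing them. *)
Lemma bm_comp_classK (h : R -> R) (E : probSpace R) (f : E -> R) :
  {in I, continuous h} -> classK I E f ->
  bounded_measurable (fun x => h (f x)).
Proof.
move=> ch /classKP[mf [a [b [Ia Ib fab]]]]; split.
  apply: (@measurable_comp _ _ _ _ _ _ I) => //.
  - exact: open_measurable.
  - by move=> _ [x _ <-]; exact: (I_itv Ia Ib).
  - exact: open_continuous_measurable_fun.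
have cab : {within `[a, b], continuous h}.
  apply: continuous_in_subspaceT => x /set_mem /=; rewrite in_itv /= => xab.
  by apply: ch; apply/mem_set; exact: (I_itv Ia Ib).
have /compact_bounded[M [_ hM]] := continuous_compact cab (@segment_compact _ a b).
exists (M + 1) => x; apply: (hM (M + 1)); first by rewrite ltrDl.
by exists (f x) => //=; rewrite in_itv /=; exact: fab.
Qed.

Lemma bm_classK (E : probSpace R) (f : E -> R) : classK I E f ->
  bounded_measurable f.
Proof. by apply: (bm_comp_classK (h := id)) => x _; exact: cvg_id. Qed.

Lemma mean_itv (E : probSpace R) (f : E -> R) a b : classK I E f ->
  (forall x, a <= f x <= b) -> a <= mean f <= b.
Proof.
move=> Kf fab; have bf := bm_classK Kf; apply/andP; split.
  rewrite -(mean_cst E a); apply: le_mean => //; first exact: bm_cst.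
  by move=> x; have /andP[] := fab x.
rewrite -(mean_cst E b); apply: le_mean => //; first exact: bm_cst.
by move=> x; have /andP[] := fab x.
Qed.

Lemma mean_classK (E : probSpace R) (f : E -> R) : classK I E f -> I (mean f).
Proof.
move=> Kf; have /classKP[_ [a [b [Ia Ib fab]]]] := Kf.
exact: (I_itv Ia Ib) (mean_itv Kf fab).
Qed.

Lemma classK_val (E : probSpace R) (f : E -> R) x : classK I E f -> I (f x).
Proof. by move=> /classKP[_ [a [b [Ia Ib fab]]]]; exact: (I_itv Ia Ib). Qed.

Lemma classK_comp (E F : probSpace R) (h : E -> F) (f : F -> R) :
  measurable_fun setT h -> classK I F f -> classK I E (fun x => f (h x)).
Proof.
move=> mh /classKP[mf [a [b [Ia Ib fab]]]]; apply/classKP; split.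
  exact: measurableT_comp.
by exists a, b; split=> // x; exact: fab.
Qed.

Lemma classK_if (E : probSpace R) (p : E -> bool) (f g : E -> R) :
  measurable_fun setT p -> classK I E f -> classK I E g ->
  classK I E (fun x => if p x then f x else g x).
Proof.
move=> mp /classKP[mf [a [b [Ia Ib fab]]]] /classKP[mg [a' [b' [Ia' Ib' gab]]]].
apply/classKP; split; first exact: measurable_fun_ifT.
exists (Num.min a a'), (Num.max b b'); split.
- by rewrite minEle; case: ifP.
- by rewrite maxEle; case: ifP.
- move=> x; have /andP[af fb] := fab x; have /andP[ag gb] := gab x.
  by rewrite ge_min le_max; case: (p x); rewrite ?af ?fb ?ag ?gb ?orbT.
Qed.

Lemma classK_cst (E : probSpace R) (a : R) : I a -> classK I E (fun _ => a).
Proof.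
move=> Ia; apply/classKP; split; first exact: measurable_cst.
by exists a, a; split=> // _; rewrite lexx.
Qed.

Lemma classK_conv (E : probSpace R) (t : R) (f g : E -> R) :
  0 <= t <= 1 -> classK I E f -> classK I E g ->
  classK I E (fun x => t * f x + (1 - t) * g x).
Proof.
move=> t01 Kf Kg; have [bf bg] := (bm_classK Kf, bm_classK Kg).
have /classKP[mf [a [b [Ia Ib fab]]]] := Kf.
have /classKP[mg [a' [b' [Ia' Ib' gab]]]] := Kg.
apply/classKP; split.
  by apply: (bm_add (bm_mul (bm_cst _ t) bf) (bm_mul (bm_cst _ (1 - t)) bg)).1.
exists (t * a + (1 - t) * a'), (t * b + (1 - t) * b'); split;
  [exact: interval_conv|exact: interval_conv|move=> x].
have /andP[af fb] := fab x; have /andP[ag gb] := gab x.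
case/andP: t01 => t0 t1.
by rewrite !lerD// ler_wpM2l// subr_ge0.
Qed.

Section product.
Variables (E F : probSpace R) (f : E * F -> R).
Hypothesis Kf : classK I (ps_prod E F) f.

Lemma classK_section1 x : classK I F (fun y => f (x, y)).
Proof.
apply: (classK_comp (F := ps_prod E F) (h := fun y => (x, y))) => //.
exact: measurable_fun_pair.
Qed.

Lemma classK_section2 y : classK I E (fun x => f (x, y)).
Proof.
by apply: (classK_comp (F := ps_prod E F) (h := fun x => (x, y))).
Qed.

Lemma classK_mean1 : classK I E (fun x => mean (fun y : F => f (x, y))).
Proof.
have bf := bm_classK Kf; have /classKP[_ [a [b [Ia Ib fab]]]] := Kf.
apply/classKP; split; first by have [] := bm_mean1 bf.
exists a, b; split=> // x; apply: mean_itv; first exact: classK_section1.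
by move=> y; exact: fab.
Qed.

Lemma classK_mean2 : classK I F (fun y => mean (fun x : E => f (x, y))).
Proof.
have bf := bm_classK Kf; have /classKP[_ [a [b [Ia Ib fab]]]] := Kf.
apply/classKP; split; first by have [] := bm_mean2 bf.
exists a, b; split=> // y; apply: mean_itv; first exact: classK_section2.
by move=> x; exact: fab.
Qed.

End product.

End classK.

(** * Entropy and duality *)

Section entropy.
Variables (R : realType) (I : set R) (Phi : R -> R).
Hypotheses (I_open : open I) (I_itv : is_interval I) (Phi_smooth : smooth_on I Phi).

Local Notation Phi1 := (Phi^`())%classic.
Local Notation Phi2 := (Phi^`(2))%classic.

Lemma continuous_smooth : {in I, continuous Phi}.
Proof.
move=> x /set_mem Ix.
exact: is_derive_continuous (smooth_is_derive Phi_smooth Ix).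
Qed.

Lemma continuous_smooth1 : {in I, continuous Phi1}.
Proof.
move=> x /set_mem Ix.
exact: is_derive_continuous (smooth_is_derive1 Phi_smooth Ix).
Qed.

Let bm_Phi (E : probSpace R) (f : E -> R) : classK I E f ->
  bounded_measurable (fun x => Phi (f x)).
Proof. exact: (bm_comp_classK I_open I_itv continuous_smooth). Qed.

Let bm_Phi1 (E : probSpace R) (f : E -> R) : classK I E f ->
  bounded_measurable (fun x => Phi1 (f x)).
Proof. exact: (bm_comp_classK I_open I_itv continuous_smooth1). Qed.

Let bm_K (E : probSpace R) (f : E -> R) : classK I E f -> bounded_measurable f.
Proof. exact: bm_classK. Qed.

Lemma bm_variational (E : probSpace R) (f g : E -> R) :
  classK I E f -> classK I E g ->
  bounded_measurable (fun x => (Phi1 (g x) - Phi1 (mean g)) * (f x - g x)).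
Proof.
move=> Kf Kg; apply: bm_mul; apply: bm_sub; try exact: bm_K.
  exact: bm_Phi1.
exact: bm_cst.
Qed.

Lemma variational_le (E : probSpace R) (f g : E -> R) :
  convex_function (E := (R^o * R^o)%type) (domT I) (transA Phi) ->
  classK I E f -> classK I E g ->
  mean (fun x => (Phi1 (g x) - Phi1 (mean g)) * (f x - g x)) + Ent Phi g
    <= Ent Phi f.
Proof.
move=> cA Kf Kg; have [bf bg] := (bm_K Kf, bm_K Kg).
have [bPf bPg bP1g] := And3 (bm_Phi Kf) (bm_Phi Kg) (bm_Phi1 Kg).
(* This is the mean of the random point (g, f - g), so the linear terms of the tangent plane there
   integrate to 0. *)
pose u0 := mean g; pose v0 := mean f - mean g.
have T0 : domT I (u0, v0).
  by split=> /=; rewrite /u0 /v0 ?subrKC; exact: mean_classK.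
pose al := Phi1 (u0 + v0) - Phi1 u0 - Phi2 u0 * v0.
pose be := Phi1 (u0 + v0) - Phi1 u0.
have bfg := bm_sub bf bg.
have bW := bm_mul bP1g bfg.
have le_pt x : transA Phi (u0, v0) + al * (g x - u0) + be * ((f x - g x) - v0)
    <= Phi (f x) - Phi (g x) - Phi1 (g x) * (f x - g x).
  have T1 : domT I (g x, f x - g x).
    by split=> /=; rewrite ?subrKC; exact: (classK_val I_itv).
  have -> : Phi (f x) - Phi (g x) - Phi1 (g x) * (f x - g x) =
    transA Phi (g x, f x - g x) by rewrite /transA /= subrKC.
  exact: (transA_tangent Phi_smooth cA T0 T1).
have bu := bm_mul (bm_cst E al) (bm_sub bg (bm_cst E u0)).
have bv := bm_mul (bm_cst E be) (bm_sub bfg (bm_cst E v0)).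
have bA := bm_add (bm_add (bm_cst E (transA Phi (u0, v0))) bu) bv.
have := le_mean bA (bm_sub (bm_sub bPf bPg) bW) le_pt.
rewrite (meanB (bm_sub bPf bPg) bW) (meanB bPf bPg).
rewrite (meanD (bm_add (bm_cst E _) bu) bv) (meanD (bm_cst E _) bu) mean_cst.
rewrite (meanZ _ (bm_sub bg (bm_cst E u0))) (meanB bg (bm_cst E u0)).
rewrite (meanZ _ (bm_sub bfg (bm_cst E v0))) (meanB bfg (bm_cst E v0)).
rewrite (meanB bf bg) !mean_cst.
rewrite !subrr !mulr0 !addr0 => H.
(* The part with the constant [Phi1 (mean g)] is the linear term of A at the mean point; Jensen's
   inequality then rearranges into the claim. *)
have -> : mean (fun x => (Phi1 (g x) - Phi1 (mean g)) * (f x - g x)) =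
    mean (fun x => Phi1 (g x) * (f x - g x)) - Phi1 (mean g) * (mean f - mean g).
  rewrite -(meanB bf bg) -(meanZ _ bfg) -meanB//; last first.
    exact: bm_mul (bm_cst _ _) bfg.
  by apply: eq_mean => x; rewrite mulrBl.
move: H; rewrite /Ent /transA /= /u0 /v0 subrKC.
lra.
Qed.

Lemma variational_of_convex (E : probSpace R) (f : E -> R) :
  convex_function (E := (R^o * R^o)%type) (domT I) (transA Phi) ->
  classK I E f -> variational Phi I f.
Proof.
move=> cA Kf; apply/eqP; rewrite eq_le; apply/andP; split.
  (* At g = f the first mean is 0: the supremum is attained. *)
  apply: ereal_sup_ubound; exists f => //; congr EFin.
  rewrite -[RHS]add0r -(mean_cst E 0); congr (_ + _).
  by apply: eq_mean => x; rewrite subrr mulr0.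
apply: ge_ereal_sup => _ [g Kg <-]; rewrite lee_fin.
exact: variational_le.
Qed.

Lemma convex_Ent_of_variational (E : probSpace R) :
  (forall f, classK I E f -> variational Phi I f) ->
  convex_function (E := E -> R^o) (classK I E) (@Ent R Phi E).
Proof.
move=> var; apply/convex_functionP => t f1 f2 t01 K1 K2.
have Kf : classK I E (t *: f1 + (1 - t) *: f2) by exact: (classK_conv I_open).
rewrite -lee_fin (var _ Kf); apply: ge_ereal_sup => _ [g Kg <-]; rewrite lee_fin.
have le_var f : classK I E f ->
    mean (fun x => (Phi1 (g x) - Phi1 (mean g)) * (f x - g x)) + Ent Phi g
    <= Ent Phi f.
  by move=> K; rewrite -lee_fin (var _ K); apply: ereal_sup_ubound; exists g.
have [b1 b2] := (bm_variational K1 Kg, bm_variational K2 Kg).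
(* For fixed g the bracket is affine in f. *)
have -> : mean (fun x => (Phi1 (g x) - Phi1 (mean g)) *
      ((t *: f1 + (1 - t) *: f2 : E -> R) x - g x)) =
    t * mean (fun x => (Phi1 (g x) - Phi1 (mean g)) * (f1 x - g x)) +
    (1 - t) * mean (fun x => (Phi1 (g x) - Phi1 (mean g)) * (f2 x - g x)).
  rewrite -!meanZ// -meanD; try by apply: bm_mul => //; exact: bm_cst.
  apply: eq_mean => x; rewrite [(_ + _) x](_ : _ = t * f1 x + (1 - t) * f2 x)//.
  by ring.
have [L1 L2] := (le_var _ K1, le_var _ K2); case/andP: t01 => t0 t1.
have := lerD (ler_wpM2l t0 L1) (ler_wpM2l (_ : 0 <= 1 - t) L2).
by rewrite subr_ge0 => /(_ t1); apply: le_trans; lra.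
Qed.

Lemma Ent_if (E : probSpace R) (A : set E) (a b : R) : measurable A ->
  Ent Phi (fun x : E => if x \in A then a else b) =
  jensen_gap Phi (fine (ps_prob E A)) (a, b).
Proof.
move=> mA; rewrite /Ent /jensen_gap /= -!mean_if//; congr (_ - _).
by apply: eq_mean => x; case: ifP.
Qed.

(** Covering supplies an event A of mass t. Functions equal to a on A and b off A depend linearly on
    (a, b), and their entropy is the gap at t. *)
Lemma convex_gap_of_Ent (P : probSpace R -> Prop) : covering P ->
  (forall E, P E ->
    convex_function (E := E -> R^o) (classK I E) (@Ent R Phi E)) ->
  forall t : R, 0 <= t <= 1 ->
    convex_function (E := (R^o * R^o)%type) (I `*` I) (jensen_gap Phi t).
Proof.
move=> covP cEnt t t01.
have [E PE [A mA PA]] : exists2 E : probSpace R, P E &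
    exists2 A : set E, measurable A & ps_prob E A = t%:E.
  have : [set r%:E | r in `[0%R, 1%R]] t%:E by exists t => //=; rewrite in_itv.
  by rewrite covP.
apply/convex_function2P => s a0 b0 a1 b1 s01 [/= Ia0 Ib0] [/= Ia1 Ib1].
have -> : t = fine (ps_prob E A) by rewrite PA.
rewrite -!Ent_if//.
have mA' : measurable_fun setT (fun x : E => x \in A).
  apply: (measurable_fun_bool true); rewrite setTI (_ : _ @^-1` _ = A)//.
  by apply/seteqP; split=> x; [move=> /set_mem|move=> ?; exact: mem_set].
have Kif a b : I a -> I b -> classK I E (fun x => if x \in A then a else b).
  by move=> Ia Ib; apply: (classK_if I_itv mA'); exact: classK_cst.
have /convex_functionP cE := cEnt E PE.
have := cE s _ _ s01 (Kif a0 b0 Ia0 Ib0) (Kif a1 b1 Ia1 Ib1).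
apply: le_trans; rewrite le_eqVlt; apply/orP; left; apply/eqP; congr Ent.
apply/funext => x; transitivity (s * (if x \in A then a0 else b0) +
  (1 - s) * (if x \in A then a1 else b1)) => //.
by case: ifP.
Qed.

End entropy.

(** * Product spaces *)

Section subadditivity.
Variables (R : realType) (I : set R) (Phi : R -> R).
Hypotheses (I_open : open I) (I_itv : is_interval I) (Phi_smooth : smooth_on I Phi).

Local Notation Phi1 := (Phi^`())%classic.

Let bm_Phi (E : probSpace R) (f : E -> R) : classK I E f ->
  bounded_measurable (fun x => Phi (f x)).
Proof.
exact: (bm_comp_classK I_open I_itv (continuous_smooth Phi_smooth)).
Qed.

Lemma mean_fst (E F : probSpace R) (g : E -> R) : bounded_measurable g ->
  mean (fun p : ps_prod E F => g p.1) = mean g.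
Proof.
move=> bg; have b1 : bounded_measurable (fun p : E * F => g p.1).
  exact: (bm_comp (h := fst)).
rewrite (mean_prod1 b1); apply: eq_mean => x; exact: (mean_cst F (g x)).
Qed.

Lemma mean_snd (E F : probSpace R) (g : F -> R) : bounded_measurable g ->
  mean (fun p : ps_prod E F => g p.2) = mean g.
Proof.
move=> bg; have b2 : bounded_measurable (fun p : E * F => g p.2).
  exact: (bm_comp (h := snd)).
rewrite (mean_prod2 b2); apply: eq_mean => x; exact: (mean_cst E (g x)).
Qed.

Lemma bm_Ent1 (E F : probSpace R) (f : E * F -> R) :
  classK I (ps_prod E F) f ->
  bounded_measurable (fun x => Ent Phi (fun y : F => f (x, y))).
Proof.
move=> Kf; apply: bm_sub; last by apply: bm_Phi; exact: classK_mean1.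
exact: (bm_mean1 (f := fun p => Phi (f p)) (bm_Phi Kf)).
Qed.

Lemma bm_Ent2 (E F : probSpace R) (f : E * F -> R) :
  classK I (ps_prod E F) f ->
  bounded_measurable (fun y => Ent Phi (fun x : E => f (x, y))).
Proof.
move=> Kf; apply: bm_sub; last by apply: bm_Phi; exact: classK_mean2.
exact: (bm_mean2 (f := fun p => Phi (f p)) (bm_Phi Kf)).
Qed.

(** Chain rule: subtract and add the mean of [Phi] at the partial mean over [F]. *)
Lemma Ent_prod (E F : probSpace R) (f : E * F -> R) :
  classK I (ps_prod E F) f ->
  Ent Phi (f : ps_prod E F -> R) =
  mean (fun x => Ent Phi (fun y : F => f (x, y))) +
  Ent Phi (fun x => mean (fun y : F => f (x, y))).
Proof.
move=> Kf; have bPf := bm_Phi Kf.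
have KG := classK_mean1 I_open I_itv Kf.
rewrite {1 3}/Ent (mean_prod1 (f := fun p => Phi (f p)) bPf).
rewrite (mean_prod1 (bm_classK I_open I_itv Kf)).
rewrite (meanB (bm_mean1 bPf) (bm_Phi KG)).
by ring.
Qed.

(* The dual formula at G = E_F f bounds [Ent f (., y)] below by [Ent G] plus a
   term that averages to 0 over y. *)
Lemma Ent_mean_le (E F : probSpace R) (f : E * F -> R) :
  convex_function (E := (R^o * R^o)%type) (domT I) (transA Phi) ->
  classK I (ps_prod E F) f ->
  Ent Phi (fun x => mean (fun y : F => f (x, y))) <=
  mean (fun y => Ent Phi (fun x : E => f (x, y))).
Proof.
move=> cA Kf; have bf := bm_classK I_open I_itv Kf.
pose G x := mean (fun y : F => f (x, y)).
have KG : classK I E G by exact: (classK_mean1 I_open I_itv Kf).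
have bG : bounded_measurable G by exact: (bm_classK I_open I_itv KG).
pose c x := Phi1 (G x) - Phi1 (mean G).
have bc : bounded_measurable c.
  apply: bm_sub; last exact: bm_cst.
  exact: (bm_comp_classK I_open I_itv (continuous_smooth1 Phi_smooth)).
pose W (p : E * F) := c p.1 * (f p - G p.1).
have bW : bounded_measurable W.
  by apply: bm_mul; [|apply: bm_sub => //]; exact: (bm_comp (h := fst)).
have mW0 : mean (fun y => mean (fun x : E => W (x, y))) = 0.
  (* Exchange the order: for fixed x, f(x, .) - G(x) has mean 0 and the factor c(x) is constant. *)
  rewrite -mean_prod2// mean_prod1// -[RHS](mean_cst E 0); apply: eq_mean => x.
  have bfx := bm_section1 bf x.
  rewrite (meanZ (c x) (bm_sub bfx (bm_cst F (G x)))) (meanB bfx (bm_cst F (G x))).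
  by rewrite mean_cst subrr mulr0.
have bWy := bm_mean2 bW.
have := le_mean (bm_add bWy (bm_cst F (Ent Phi G))) (bm_Ent2 Kf).
rewrite (meanD bWy (bm_cst F _)) mean_cst mW0 add0r; apply => y.
exact: (variational_le I_open I_itv Phi_smooth cA (classK_section2 I_itv Kf y) KG).
Qed.

(** The extra factor [X] stores the coordinates already passed, which the induction on [s] requires
    as parameters. *)
Lemma bm_Ent_coord (s : seq (probSpace R)) (i : nat) (X E : probSpace R)
    (f : X * ps_bigprod E s -> R) :
  classK I (ps_prod X (ps_bigprod E s)) f ->
  bounded_measurable (fun p : X * ps_bigprod E s =>
    Ent_coord Phi i (fun z => f (p.1, z)) p.2).
Proof.
elim: s i X E f => [|F s IH] i X E f Kf.
  exact: (bm_comp (h := fst) measurable_fst (bm_Ent1 Kf)).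
case: i => [|i].
  (* Bring [E] to the front, so that its entropy is taken in the first factor of a binary
     product. *)
  pose h (q : E * (X * ps_bigprod F s)) := (q.2.1, (q.1, q.2.2)).
  have Kh : classK I (ps_prod E (ps_prod X (ps_bigprod F s))) (fun q => f (h q)).
    apply: (@classK_comp R I I_itv (ps_prod E (ps_prod X (ps_bigprod F s)))
      (ps_prod X (ps_bigprod E (F :: s))) h f _ Kf).
    apply: measurable_fun_pair; first exact: measurableT_comp.
    by apply: measurable_fun_pair => //; exact: measurableT_comp.
  apply: (bm_comp (h := fun p : X * (E * ps_bigprod F s) => (p.1, p.2.2)) _ (bm_Ent2 Kh)).
  by apply: measurable_fun_pair => //; exact: measurableT_comp.
(* Reassociate, so that [E] joins the parameters. *)
pose h (q : (X * E) * ps_bigprod F s) := (q.1.1, (q.1.2, q.2)).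
have Kh : classK I (ps_prod (ps_prod X E) (ps_bigprod F s)) (fun q => f (h q)).
  apply: (@classK_comp R I I_itv (ps_prod (ps_prod X E) (ps_bigprod F s))
    (ps_prod X (ps_bigprod E (F :: s))) h f _ Kf).
  apply: measurable_fun_pair; first exact: measurableT_comp.
  by apply: measurable_fun_pair => //; exact: measurableT_comp.
apply: (bm_comp (h := fun p : X * (E * ps_bigprod F s) => ((p.1, p.2.1), p.2.2)) _
  (IH i (ps_prod X E) F _ Kh)).
apply: measurable_fun_pair; last exact: measurableT_comp.
by apply: measurable_fun_pair => //; exact: measurableT_comp.
Qed.

Lemma bm_sum (E : probSpace R) n (f : 'I_n -> E -> R) :
  (forall i, bounded_measurable (f i)) ->
  bounded_measurable (fun x => \sum_(i < n) f i x).
Proof.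
elim: n f => [|n IH] f bf.
  rewrite (_ : (fun x => _) = fun _ => 0); first exact: bm_cst.
  by apply/funext => x; rewrite big_ord0.
rewrite (_ : (fun x => _) = fun x => f ord0 x + \sum_(i < n) f (lift ord0 i) x).
  by apply: bm_add => //; exact: IH.
by apply/funext => x; rewrite big_ord_recl.
Qed.

Lemma mean_sum (E : probSpace R) n (f : 'I_n -> E -> R) :
  (forall i, bounded_measurable (f i)) ->
  mean (fun x => \sum_(i < n) f i x) = \sum_(i < n) mean (f i).
Proof.
elim: n f => [|n IH] f bf.
  by rewrite big_ord0 -[RHS](mean_cst E 0); apply: eq_mean => x; rewrite big_ord0.
rewrite big_ord_recl -IH// -meanD//; last exact: bm_sum.
by apply: eq_mean => x; rewrite big_ord_recl.
Qed.

(** Induction on the factors. The chain rule leaves the entropy of the partial mean, bounded by the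
    term of coordinate 0, and the mean of the entropies of sections, to which induction applies. *)
Lemma subadditive_of_convex (E : probSpace R) (s : seq (probSpace R)) :
  convex_function (E := (R^o * R^o)%type) (domT I) (transA Phi) ->
  subadditive_Ent Phi I E s.
Proof.
move=> cA; elim: s E => [|F s IH] E f Kf.
  by rewrite big_ord1 /= mean_cst.
have Kf' : classK I (ps_prod E (ps_bigprod F s)) f by [].
rewrite (Ent_prod Kf') addrC big_ord_recl; apply: lerD.
  have bE := bm_Ent2 Kf'.
  apply: (le_trans (Ent_mean_le cA Kf')).
  by rewrite -(mean_snd E bE); exact: lexx.
have bc i : bounded_measurable (fun p : E * ps_bigprod F s =>
    Ent_coord Phi i (fun z => f (p.1, z)) p.2) by exact: bm_Ent_coord.
have bcm i := bm_mean1 (bc i).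
apply: (@le_trans _ _ (mean (fun x => \sum_(i < (size s).+1)
    mean (fun z => Ent_coord Phi i (fun z => f (x, z)) z)))).
  apply: le_mean; first exact: bm_Ent1.
    by apply: bm_sum => i; exact: bcm.
  by move=> x; apply: IH; exact: classK_section1.
rewrite mean_sum//; apply: ler_sum => i _.
by rewrite [leRHS](mean_prod1 (bc i)).
Qed.

(** The event [[set true]] has mass r under the Bernoulli law of parameter r. *)
Lemma covering_all : covering (fun _ : probSpace R => True).
Proof.
apply/seteqP; split=> [_ [r /= r01 <-]|_ [E _ [A mA <-]]].
  have r01' : 0 <= r <= 1 by move: r01; rewrite in_itv.
  exists (bernoulli_space r) => //; exists [set true] => //=.
  rewrite bernoulli_probE// !diracE mem_set// memNset//=.
  by rewrite mule1 mule0 adde0.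
have fin := fin_num_measure (ps_prob E) A mA.
exists (fine (ps_prob E A)); last by rewrite fineK.
rewrite /= in_itv /= fine_ge0//= -lee_fin fineK//.
exact: probability_le1.
Qed.

Lemma mean_bernoulli (p : R) (h : bernoulli_space p -> R) : 0 <= p <= 1 ->
  mean h = p * h true + (1 - p) * h false.
Proof.
move=> p01; have pE : fine (ps_prob (bernoulli_space p) [set true]) = p.
  rewrite /= bernoulli_probE// !diracE mem_set// memNset//=.
  by rewrite mulr1 mulr0 addr0.
rewrite -{2 3}pE -mean_if//; apply: eq_mean => -[]; first by rewrite mem_set.
by rewrite memNset.
Qed.

(** Choose between f1 and f2 by a Bernoulli variable of parameter t. The mean of Phi(F) occurs on
    both sides and cancels; the entropy of the mixture m remains on the left, the average of the two
    entropies on the right. *)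
Lemma convex_Ent_of_subadditive (E : probSpace R) :
  (forall p : R, 0 <= p <= 1 -> subadditive_Ent Phi I (bernoulli_space p) [:: E]) ->
  convex_function (E := E -> R^o) (classK I E) (@Ent R Phi E).
Proof.
move=> sub; apply/convex_functionP => t f1 f2 t01 K1 K2.
pose B := bernoulli_space t.
pose F (q : B * E) := if q.1 then f1 q.2 else f2 q.2.
have KF : classK I (ps_prod B E) F.
  apply: (classK_if I_itv (E := ps_prod B E) (p := fst)); first exact: measurable_fst.
    exact: (@classK_comp R I I_itv (ps_prod B E) E snd).
  exact: (@classK_comp R I I_itv (ps_prod B E) E snd).
have := sub t t01 F KF; rewrite !big_ord_recl big_ord0 addr0.
have bPF := bm_Phi KF; have bF := bm_classK I_open I_itv KF.
pose m y := t * f1 y + (1 - t) * f2 y.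
have Km : classK I E m by exact: (classK_conv I_open).
have bPm := bm_Phi Km.
have meanF y : mean (fun b : B => F (b, y)) = m y by rewrite mean_bernoulli.
have meanPF : mean (fun q : ps_prod B E => Phi (F q)) =
    mean (fun y => mean (fun b : B => Phi (F (b, y)))) by exact: (mean_prod2 bPF).
have -> : Ent Phi (F : ps_prod B E -> R) =
    mean (fun q : ps_prod B E => Phi (F q)) - Phi (mean m).
  rewrite /Ent (mean_prod2 bF); congr (_ - Phi _).
  by apply: eq_mean => y; rewrite meanF.
have -> : mean (Ent_coord Phi (ord0 : 'I_2) (s := [:: E]) F) =
    mean (fun q : ps_prod B E => Phi (F q)) - mean (fun y => Phi (m y)).
  rewrite [LHS](mean_snd B (bm_Ent2 KF)) meanPF -(meanB (bm_mean2 bPF) bPm).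
  by apply: eq_mean => y; rewrite /Ent meanF.
have -> : mean (Ent_coord Phi (lift ord0 (ord0 : 'I_1)) (s := [:: E]) F) =
    t * Ent Phi f1 + (1 - t) * Ent Phi f2.
  by rewrite [LHS](mean_fst E (bm_Ent1 KF)) mean_bernoulli.
have -> : Ent Phi (t *: f1 + (1 - t) *: f2 : E -> R) =
  mean (fun y => Phi (m y)) - Phi (mean m) by [].
by lra.
Qed.

End subadditivity.

(** * The cycle of equivalences *)

Theorem theorem4p4 (R : realType) (I : set R) (Phi : R -> R)
    (I_open : open I) (I_itv : is_interval I) (Phi_smooth : smooth_on I Phi) :
  [<-> (*  1 *) convex_function (E := (R^o * R^o)%type) (domT I) (transA Phi);
       (*  2 *) convex_function (E := (R^o * R^o)%type) (domT I) (transB Phi);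
       (*  3 *) convex_function (E := (R^o * R^o)%type) (domT' I) (transC Phi);
       (*  4 *) affine_on I Phi \/
                ((forall x, I x -> 0 < (Phi^`(2))%classic x) /\
                 convex_function (E := R^o) I
                   (fun x => - 1 / (Phi^`(2))%classic x));
       (*  5 *) forall t : R, 0 <= t <= 1 ->
                convex_function (E := (R^o * R^o)%type) (I `*` I)
                  (jensen_gap Phi t);
       (*  6 *) forall E : probSpace R,
                convex_function (E := E -> R^o) (classK I E) (@Ent R Phi E);
       (*  7 *) exists2 P : probSpace R -> Prop, covering P &
                forall E, P E ->
                convex_function (E := E -> R^o) (classK I E) (@Ent R Phi E);
       (*  8 *) forall (E : probSpace R) f,
                classK I E f -> variational Phi I f;
       (*  9 *) exists2 P : probSpace R -> Prop, covering P &
                forall E, P E -> forall f, classK I E f -> variational Phi I f;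
       (* 10 *) forall (E : probSpace R) (s : seq (probSpace R)),
                subadditive_Ent Phi I E s;
       (* 11 *) exists2 P : probSpace R -> Prop, covering P &
                forall p : R, 0 <= p <= 1 -> forall E, P E ->
                subadditive_Ent Phi I (bernoulli_space p) [:: E]]
  /\
  (convex_function (E := (R^o * R^o)%type) (domT I) (transA Phi) ->
   convex_function (E := R^o) I Phi /\
   convex_function (E := R^o) I (Phi^`(2))%classic).
Proof.
have step12 := @convex_transB_of_transA R I Phi.
have step23 := convex_transC_of_transB I_open I_itv Phi_smooth.
have step34 := affine_or_convex_inv I_open I_itv Phi_smooth.
have step43 := convex_transC_of_inv I_open I_itv Phi_smooth.
have step31 := convex_transA_of_transC I_itv Phi_smooth.
have step51 := convex_transA_of_gap I_itv Phi_smooth.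
have step75 := convex_gap_of_Ent (Phi := Phi) I_itv.
have step18 E f := @variational_of_convex _ _ _ I_open I_itv Phi_smooth E f.
have step86 E := @convex_Ent_of_variational _ _ _ I_open I_itv Phi_smooth E.
have step1_10 E s := @subadditive_of_convex _ _ _ I_open I_itv Phi_smooth E s.
have step11_7 E := @convex_Ent_of_subadditive _ _ _ I_open I_itv Phi_smooth E.
have cov := covering_all R.
split; last first.
  move=> /step12/step23 cC.
  by split; [exact: convex_Phi|exact: convex_derive2].
tfae.
- exact: step12.
- exact: step23.
- exact: step34.
(* From the convexity of A to the gap the route is through entropy: duality on every space, convex
   entropy, then two-valued functions. *)
- move=> /step43/step31 c1; apply: (step75 _ cov) => E _.
  by apply: step86 => f; exact: step18.
- by move=> /step51 c1 E; apply: step86 => f; exact: step18.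
- by move=> c6; exists (fun _ => True).
- by move=> [P covP cP] E f; apply: step18; apply: step51; exact: step75 covP cP.
- by move=> c8; exists (fun _ => True) => // E _; exact: c8.
(* Duality on a covering collection yields the gap, hence the convexity of A, which serves on every
   product. *)
- move=> [P covP vP] E s; apply: step1_10; apply: step51.
  apply: (step75 P covP) => F PF.
  by apply: step86; exact: vP.
- by move=> c10; exists (fun _ => True) => // p _ E _; exact: c10.
- move=> [P covP sP]; apply: step51; apply: (step75 P covP) => E PE.
  by apply: step11_7 => p p01; exact: sP.
Qed.
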